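(* Let $(X,\mathcal{A},\mu)$ be a measure space. An ideal $I$ in $\mathcal{M}(X,\mathcal{A})$ is closed in the $m_\mu$-topology if and only if it is a $Z_\mu$-ideal.
   Context: $X$ is a non-empty set, $\mathcal{A}$ a $\sigma$-algebra on $X$, $\mu:\mathcal{A}\to[0,\infty]$ a measure. $\mathcal{M}(X,\mathcal{A})$ is the commutative ring of all measurable functions $X\to\mathbb{R}$ under pointwise operations. A $\mu$-null set is a set $E\in\mathcal{A}$ with $\mu(E)=0$. A positive unit of $\mathcal{M}(X,\mathcal{A})$ is a $u\in\mathcal{M}(X,\mathcal{A})$ with $u(x)>0$ for all $x\in X$. The $m_\mu$-topology on $\mathcal{M}(X,\mathcal{A})$ has as open base the sets $m_\mu(f,u)=\{g\in\mathcal{M}(X,\mathcal{A}):$ there is a $\mu$-null set $E$ with $|f(x)-g(x)|<u(x)$ for all $x\in X\setminus E\}$, $f\in\mathcal{M}(X,\mathcal{A})$, $u$ a positive unit. $Z(f)=\{x\in X: f(x)=0\}$ and $Z[I]=\{Z(f): f\in I\}$. An ideal $I$ (not necessarily proper) is a $Z_\mu$-ideal if whenever $f\in\mathcal{M}(X,\mathcal{A})$ vanishes $\mu$-almost everywhere on some $Z\in Z[I]$ (i.e. $\mu(Z\setminus Z(f))=0$), then $f\in I$; equivalently, whenever $f\in\mathcal{M}(X,\mathcal{A})$ equals some $g\in I$ $\mu$-almost everywhere on $X$, then $f\in I$. *)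

(* Defs.v *)
From HB Require Import structures.
From mathcomp Require Import all_boot all_order all_algebra.
From mathcomp Require Import all_classical all_reals all_analysis.
From mathcomp Require Import measurable_realfun.

Set Implicit Arguments.
Unset Strict Implicit.
Unset Printing Implicit Defensive.
Import Order.TTheory GRing.Theory Num.Theory.
Import numFieldNormedType.Exports.

Local Open Scope classical_set_scope.
Local Open Scope ring_scope.

(* Unlike MathComp's idealr, an ideal may contain 1. *)
Definition is_ideal (A : comNzRingType) (I : set A) : Prop :=
  [/\ I 0,
      forall f g, I f -> I g -> I (f + g)
    & forall f g, I g -> I (f * g)].

(* Alias of {mfun X >-> R} carrying the m_mu-topology; mu, absent from the
   body, selects the topology. *)
Definition mmu_space d (X : measurableType d) (R : realType)
  (mu : {measure set X -> \bar R}) : Type := {mfun X >-> R}.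

Section mmu.
Context d (X : measurableType d) (R : realType).
Variable mu : {measure set X -> \bar R}.

Definition mu_null (E : set X) : Prop := measurable E /\ mu E = 0%E.

Definition positive_unit : set {mfun X >-> R} := [set u | forall x, 0 < u x].

Definition mmu_ball (f u : {mfun X >-> R}) : set {mfun X >-> R} :=
  [set g | exists2 E, mu_null E &
    forall x, (~` E) x -> `|f x - g x| < u x].

Definition mmu_base : set (set {mfun X >-> R}) :=
  [set mmu_ball f u | f in setT & u in positive_unit].

Lemma mmu_ball_center (f u : {mfun X >-> R}) :
  positive_unit u -> mmu_ball f u f.
Proof.
move=> u0; exists set0; first by split; [exact: measurable0|exact: measure0].
by move=> x _; rewrite subrr normr0; exact: u0.
Qed.

Lemma mmu_base_cover : \bigcup_(B in mmu_base) B = setT.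
Proof.
apply/seteqP; split=> // f _.
have p1 : positive_unit 1 by move=> x; rewrite mfun1.
by exists (mmu_ball f 1); [exists f => //; exists 1|exact: mmu_ball_center].
Qed.

Lemma mmu_ball_open (f u g : {mfun X >-> R}) :
  positive_unit u -> mmu_ball f u g ->
  exists2 w, positive_unit w & mmu_ball g w `<=` mmu_ball f u.
Proof.
move=> u0 [E [mE E0] fgu].
pose m : X -> R := fun x => u x - `|f x - g x|.
have mm : measurable_fun setT m.
  apply: measurable_funB => //.
  by apply: measurableT_comp => //; exact: measurable_funB.
pose w0 : X -> R := fun x => if 0 < m x then m x else 1.
have mw0 : measurable_fun setT w0.
  apply: measurable_fun_ifT => //.
  exact: measurable_fun_ltr.
pose w : {mfun X >-> R} := HB.pack w0 (isMeasurableFun.Build _ _ _ _ w0 mw0).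
exists w.
  by move=> x; rewrite /w /= /w0; case: ifPn.
move=> h [F [mF F0] ghw]; exists (E `|` F).
  by split; [exact: measurableU|rewrite measureU0].
move=> x; rewrite setCU => -[nEx nFx].
have := ghw x nFx; rewrite /w /= /w0 /m subr_gt0 (fgu x nEx).
rewrite ltrBrDl; apply: le_lt_trans.
by rewrite -(subrKA (g x)) ler_normD.
Qed.

Lemma mmu_ballI (g v w : {mfun X >-> R}) :
  positive_unit v -> positive_unit w ->
  exists2 t, positive_unit t &
    mmu_ball g t `<=` mmu_ball g v `&` mmu_ball g w.
Proof.
move=> v0 w0; exists (min_mfun v w).
  by move=> x; rewrite /= lt_min v0 w0.
by move=> h [F F0 ghF]; split; exists F => // x /ghF /=;
  rewrite lt_min => /andP[].
Qed.

Lemma mmu_base_join (B C : set {mfun X >-> R}) (g : {mfun X >-> R}) :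
  mmu_base B -> mmu_base C -> B g -> C g ->
  exists D, [/\ mmu_base D, D g & D `<=` B `&` C].
Proof.
move=> [f _ [u u0 <-]] [h _ [v v0 <-]] fug hvg.
have [u' u'0 su] := mmu_ball_open u0 fug.
have [v' v'0 sv] := mmu_ball_open v0 hvg.
have [t t0 st] := mmu_ballI g u'0 v'0.
exists (mmu_ball g t); split; [by exists g => //; exists t|
  exact: mmu_ball_center|].
by move=> k /st [/su ? /sv].
Qed.

HB.instance Definition _ := Choice.on (mmu_space mu).
HB.instance Definition _ := isBaseTopological.Build (mmu_space mu)
  mmu_base_cover mmu_base_join.

Definition zero_set (f : {mfun X >-> R}) : set X := [set x | f x = 0].

Definition zero_sets (I : set {mfun X >-> R}) : set (set X) :=
  [set zero_set f | f in I].

Definition Zmu_ideal (I : set {mfun X >-> R}) : Prop :=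
  is_ideal I /\
  forall (f : {mfun X >-> R}) (Z : set X),
    zero_sets I Z -> mu (Z `\` zero_set f) = 0%E -> I f.

End mmu.

(* Main.v *)
(** Both directions rest on [f] being in [I] as soon as [f] vanishes almost
    everywhere on [Z(g)] for some [g] in [I].  If [I] is closed, such an [f] is a
    limit of elements of [I], because the ring is von Neumann regular: the
    multiple [f g^-1 g] of [g] is almost everywhere equal to [f], so it lies in
    every basic neighbourhood of [f].  Conversely, given [f] in the closure of
    [I], let [u] be [|f|] off [Z(f)] and [1] on it: a [g] in [I] with
    [|f - g| < u] almost everywhere cannot vanish, up to a null set, where [f]
    does not. *)

Require Import Defs.
From mathcomp Require Import all_boot all_order all_algebra.
From mathcomp Require Import all_classical all_reals all_analysis.
From mathcomp Require Import measurable_realfun.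
From HB Require Import structures.
Import Order.TTheory GRing.Theory Num.Theory.
Import numFieldNormedType.Exports.

Local Open Scope classical_set_scope.
Local Open Scope ring_scope.

(** Inversion is continuous off [0], and on the remaining singleton any map is measurable. *)
Lemma measurable_inv (R : realType) : measurable_fun setT (@GRing.inv R).
Proof.
rewrite -(setUv [set 0]); apply/measurable_funU => //; first exact: measurableC.
split; first exact: measurable_fun_set1.
apply: open_continuous_measurable_fun.
  by rewrite openC; exact: closed_eq.
by move=> x /set_mem /= /eqP x0; exact: inv_continuous.
Qed.

Section mmu_topology.
Context {d : measure_display} {X : measurableType d} {R : realType}.
Variable mu : {measure set X -> \bar R}.
Implicit Types (f g u : {mfun X >-> R}) (I : set {mfun X >-> R}).

Lemma measurable_zero_set f : measurable (zero_set f).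
Proof.
change (measurable (f @^-1` [set 0])).
exact: (@measurable_funPTI _ _ _ _ f _ (measurable_set1 0)).
Qed.

Lemma open_mmu_ball f u :
  positive_unit u -> open (mmu_ball mu f u : set (mmu_space mu)).
Proof.
move=> u0; exists [set mmu_ball mu f u]; last by rewrite bigcup_set1.
by move=> _ ->; exists f => //; exists u.
Qed.

Lemma nbhs_mmu_ball (f : mmu_space mu) (B : set (mmu_space mu)) : nbhs f B ->
  exists2 u, positive_unit u & mmu_ball mu f u `<=` B.
Proof.
rewrite nbhsE => -[U [[D' D'base <-] [V D'V Vf]] UB].
have [g _ [v v0 gvE]] := D'base _ D'V.
(* The basic set [V] contains [f] but may be centred at another [g]; it has to be shrunk to a ball
   centred at [f]. *)
have [u u0 fuV] : exists2 u, positive_unit u & mmu_ball mu f u `<=` V.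
  by rewrite -gvE; apply: mmu_ball_open => //; rewrite gvE.
by exists u => // h /fuV Vh; apply: UB; exists V.
Qed.

Lemma closure_mmuP I f : closure (I : set (mmu_space mu)) f <->
  forall u, positive_unit u -> exists2 g, I g & mmu_ball mu f u g.
Proof.
split=> [If u u0|If B /nbhs_mmu_ball[u u0 fuB]].
  have /If[g [Ig fug]] : nbhs (f : mmu_space mu) (mmu_ball mu f u).
    by apply: open_nbhs_nbhs; split; [exact: open_mmu_ball|
      exact: mmu_ball_center].
  by exists g.
by have [g Ig /fuB Bg] := If u u0; exists g.
Qed.

(* [0^-1 = 0] makes [inv_mfun g] a quasi-inverse: [g * inv_mfun g * g = g]. *)
Definition inv_mfun_fun g : X -> R := fun x => (g x)^-1.

Lemma measurable_inv_mfun g : measurable_fun setT (inv_mfun_fun g).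
Proof. exact: measurableT_comp (@measurable_inv R) _. Qed.

Definition inv_mfun g : {mfun X >-> R} :=
  HB.pack (inv_mfun_fun g)
    (isMeasurableFun.Build _ _ _ _ (inv_mfun_fun g) (measurable_inv_mfun g)).

Definition norm_or1_fun f : X -> R := fun x => if f x == 0 then 1 else `|f x|.

Lemma measurable_norm_or1 f : measurable_fun setT (norm_or1_fun f).
Proof.
apply: measurable_fun_ifT => //; first exact: measurable_fun_eqr.
exact: measurableT_comp.
Qed.

Definition norm_or1 f : {mfun X >-> R} :=
  HB.pack (norm_or1_fun f)
    (isMeasurableFun.Build _ _ _ _ (norm_or1_fun f) (measurable_norm_or1 f)).

Lemma norm_or1_gt0 f : positive_unit (norm_or1 f).
Proof.
move=> x; rewrite /= /norm_or1_fun.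
by case: ifPn => // fx0; rewrite normr_gt0.
Qed.

Lemma closure_vanishing_ae I f g : is_ideal I -> I g ->
  mu (zero_set g `\` zero_set f) = 0%E -> closure (I : set (mmu_space mu)) f.
Proof.
move=> [_ _ IM] Ig gf0; apply/closure_mmuP => u u0.
(* One witness serves every [u], as it agrees with [f] off a null set that does not depend on
   [u]. *)
exists (f * inv_mfun g * g); first exact: IM.
exists (zero_set g `\` zero_set f).
  by split=> //; apply: measurableD; exact: measurable_zero_set.
move=> x gfx.
suff -> : (f * inv_mfun g * g) x = f x by rewrite subrr normr0; exact: u0.
change (f x * (g x)^-1 * g x = f x).
have [gx0|gx0] := eqVneq (g x) 0; last by rewrite mulfVK.
(* At a zero of [g] the witness is [0]; so is [f], since [x] lies outside the exceptional set. *)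
have -> : f x = 0 by apply: contrapT => fx0; apply: gfx.
by rewrite !mul0r.
Qed.

(** Where [g] vanishes and [f] does not, [|f - g| = |f|] is exactly the radius, so the strict
    inequality fails and the point lies in the null set [E]. *)
Lemma mmu_ball_norm_or1 f g : mmu_ball mu f (norm_or1 f) g ->
  mu (zero_set g `\` zero_set f) = 0%E.
Proof.
move=> [E [mE E0] fg]; apply: (subset_measure0 _ mE _ E0).
  by apply: measurableD; exact: measurable_zero_set.
move=> x [/= gx0 /eqP fx0]; apply: contrapT => /fg.
by rewrite gx0 subr0 /= /norm_or1_fun (negbTE fx0) ltxx.
Qed.

End mmu_topology.

Theorem corollary5p19 (d : measure_display) (X : measurableType d)
    (R : realType) (mu : {measure set X -> \bar R})
    (I : set {mfun X >-> R}) (idI : is_ideal I) :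
  closed (I : set (mmu_space mu)) <-> Zmu_ideal mu I.
Proof.
split=> [clI|[_ ZI] f /closure_mmuP If].
  split=> // f _ [g Ig <-] gf0; apply: clI.
  exact: closure_vanishing_ae gf0.
have [g Ig fg] := If _ (norm_or1_gt0 f).
by apply: ZI (mmu_ball_norm_or1 _ _ _ fg); exists g.
Qed.
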